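(* Let $I$ be a compact interval and let $(X_n,d_n)$ be a sequence of compact length spaces. Let $(X,d)$ be a compact length space such that $(X_n,d_n)\to(X,d)$ in the Gromov-Hausdorff sense. Then $(I\times_1X_n,\hat d_{n,1})\to(I\times_1X,\hat d_1)$ in the Gromov-Hausdorff sense, where $\hat d_{n,1}$ and $\hat d_1$ denote the null distances of the generalized cones $I\times_1X_n$ and $I\times_1X$ with constant warping function $1$.
   Context: Length space: a metric space $(X,d)$ in which $d(x,y)$ is the infimum of the $d$-lengths of curves joining $x$ and $y$; it is assumed throughout that any two points can be joined by a curve of finite length. Generalized cone: let $I\subseteq\mathbb R$ be a nondegenerate interval and $f:I\to(0,\infty)$ continuous. The generalized cone $Y=I\times_f X$ is the set $I\times X$ with the product metric $D((t,x),(t',x'))=|t-t'|+d(x,x')$ and the following causal structure. A curve $\gamma=(\alpha,\beta):J\to Y$ on an interval $J$, with $\alpha:J\to I$ and $\beta:J\to X$ absolutely continuous and $\alpha$ strictly monotone, is causal if $-\dot\alpha^2+(f\circ\alpha)^2v_\beta^2\le 0$ almost everywhere, where $v_\beta$ is the metric derivative of $\beta$; it is future (past) directed causal if moreover $\dot\alpha>0$ ($\dot\alpha<0$) a.e. Here $f\equiv1$. Null distance: a curve $\beta:[a,b]\to Y$ is piecewise causal if there is a partition $a=s_0<\dots<s_k=b$ such that each $\beta|_{[s_{i-1},s_i]}$ is constant, future directed causal or past directed causal. With the time function $t:Y\to\mathbb R$, $t(s,x)=s$, its null length is $\hat L_t(\beta)=\sum_{i=1}^k|t(\beta(s_i))-t(\beta(s_{i-1}))|$,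 and the null distance $\hat d_f(p,q)$ is the infimum of $\hat L_t(\beta)$ over all piecewise causal curves $\beta$ from $p$ to $q$. *)

(* Defs.v *)
From HB Require Import structures.
From mathcomp Require Import all_boot all_order all_algebra.
From mathcomp Require Import all_classical all_reals all_analysis.

Set Implicit Arguments.
Unset Strict Implicit.
Unset Printing Implicit Defensive.

Import Order.TTheory GRing.Theory Num.Theory.
Import numFieldNormedType.Exports.

Local Open Scope classical_set_scope.
Local Open Scope ring_scope.

(* Curves on a compact interval [a, b] are total functions on R of which only
   the values on [a, b] matter. *)
Section Curves.
Context {R : realType} {X : metricType R}.
Implicit Types (a b s v : R) (beta : R -> X).

Definition curve_length a b beta : \bar R :=
  ereal_sup [set (\sum_(i < size s)
      mdist (beta (nth b (a :: s) i)) (beta (nth b (a :: s) i.+1)))%:E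
    | s in itv_partition a b].

Definition abs_continuous a b beta : Prop :=
  forall e, 0 < e -> exists2 d, 0 < d &
    forall n (u v : nat -> R),
      (forall i, (i < n)%N -> a <= u i /\ u i <= v i /\ v i <= b) ->
      trivIset `I_n (fun i => `]u i, v i[%classic) ->
      \sum_(i < n) (v i - u i) < d ->
      \sum_(i < n) mdist (beta (u i)) (beta (v i)) < e.

Definition is_metric_derivative beta s v : Prop :=
  mdist (beta s) (beta (s + h)) / `|h| @[h --> 0^'] --> v.

End Curves.

(* The infimum being a real number, any two points of a length space are joined
   by a curve of finite length. *)
Definition length_space {R : realType} (X : metricType R) : Prop :=
  forall x y : X, (mdist x y)%:E =
    ereal_inf [set l | exists a b (beta : R -> X),
      [/\ a < b, {within `[a, b], continuous beta}, beta a = x, beta b = y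
        & l = curve_length a b beta]].

Definition gen_cone {R : realType} (I : set R) (X : Type) : Type :=
  (set_type I * X)%type.

Section GeneralizedCone.
Context {R : realType} (I : set R) (X : metricType R).
Variable f : set_type I -> R.
Implicit Types (a b : R) (gamma : R -> gen_cone I X) (p q : gen_cone I X).

Definition time p : R := set_val p.1.

Definition strictly_monotone_on a b (alpha : R -> R) : Prop :=
  {in `[a, b] &, {homo alpha : s t / s < t}} \/
  {in `[a, b] &, {homo alpha : s t /~ s < t}}.

(* The derivative of alpha and the metric derivative of beta exist almost
   everywhere by absolute continuity, so requiring their existence in the
   almost-everywhere condition is no restriction. *)
Definition causal a b gamma : Prop :=
  let alpha := time \o gamma in
  let beta s := (gamma s).2 in
  [/\ @abs_continuous R R^o a b alpha,
      abs_continuous a b beta,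
      strictly_monotone_on a b alpha
    & {ae @lebesgue_measure R, forall s, s \in `]a, b[ ->
        derivable alpha s 1 /\
        exists2 v, is_metric_derivative beta s v &
          - derive1 alpha s ^+ 2 + f (gamma s).1 ^+ 2 * v ^+ 2 <= 0}].

Definition future_causal a b gamma : Prop :=
  causal a b gamma /\
  {ae @lebesgue_measure R, forall s, s \in `]a, b[ ->
    0 < derive1 (time \o gamma) s}.

Definition past_causal a b gamma : Prop :=
  causal a b gamma /\
  {ae @lebesgue_measure R, forall s, s \in `]a, b[ ->
    derive1 (time \o gamma) s < 0}.

Definition constant_on a b gamma : Prop :=
  exists y, forall s, s \in `[a, b] -> gamma s = y.

(* The partition a = s_0 < ... < s_k = b is the sequence a :: s. *)
Definition piecewise_causal a b (s : seq R) gamma : Prop :=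
  itv_partition a b s /\
  forall i, (i < size s)%N ->
    let l := nth b (a :: s) i in
    let r := nth b (a :: s) i.+1 in
    [\/ constant_on l r gamma, future_causal l r gamma
      | past_causal l r gamma].

Definition null_length a b (s : seq R) gamma : R :=
  \sum_(i < size s) `|time (gamma (nth b (a :: s) i.+1)) -
                      time (gamma (nth b (a :: s) i))|.

Definition null_dist p q : \bar R :=
  ereal_inf [set l | exists a b s gamma,
    [/\ a < b, piecewise_causal a b s gamma, gamma a = p, gamma b = q
      & l = (null_length a b s gamma)%:E]].

End GeneralizedCone.

Section GromovHausdorff.
Context {R : realType}.

Definition hausdorff_dist (Z : metricType R) (A B : set Z) : \bar R :=
  ereal_inf [set r%:E | r in [set r : R | [/\ 0 < r,
    A `<=` \bigcup_(z in B) ball z r & B `<=` \bigcup_(z in A) ball z r]]].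

(* A distance function d : S -> S -> \bar R admits an isometric embedding into
   some metric space exactly when d is a (finite) metric on S. *)
Definition isometric_embedding (S : Type) (d : S -> S -> \bar R)
    (Z : metricType R) (phi : S -> Z) : Prop :=
  injective phi /\ forall x y, (mdist (phi x) (phi y))%:E = d x y.

(* The value is +oo unless (S, dS) and (T, dT) are both metric spaces. *)
Definition gh_dist (S T : Type) (dS : S -> S -> \bar R) (dT : T -> T -> \bar R)
    : \bar R :=
  ereal_inf [set h | exists (Z : metricType R) (phi : S -> Z) (psi : T -> Z),
    [/\ isometric_embedding dS phi, isometric_embedding dT psi
      & h = hausdorff_dist (range phi) (range psi)]].

Definition gh_cvg (S_ : nat -> Type) (d_ : forall n, S_ n -> S_ n -> \bar R)
    (S : Type) (d : S -> S -> \bar R) : Prop :=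
  gh_dist (d_ n) d @[n --> \oo] --> 0%E.

Definition dist_of (X : metricType R) (x y : X) : \bar R := (mdist x y)%:E.

End GromovHausdorff.

(* Main.v *)
Require Import Defs.
From HB Require Import structures.
From mathcomp Require Import all_boot all_order all_algebra.
From mathcomp Require Import all_classical all_reals all_analysis.
From mathcomp Require Import measurable_realfun ring lra.

Import Order.TTheory GRing.Theory Num.Theory.
Import numFieldNormedType.Exports.

Local Open Scope classical_set_scope.
Local Open Scope ring_scope.

(** With warping function 1 the null distance has a closed form: if [X] is a
compact length space and [c < d], then on [[c, d] x X] the null distance of
[(s, x)] and [(t, y)] is [max (|t - s|) (d(x, y))] ([null_distE]).  Once this
is known, the theorem is a remark about products.  If [phi] and [psi] embed
[X_n] and [X] isometrically in [Z], then [id x phi] and [id x psi] embed the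
two cones isometrically in [R x Z] with the maximum metric, and moving a point
only in its second coordinate shows that the Hausdorff distance of the images
does not increase.  Hence the Gromov-Hausdorff distance of the cones is at most
that of [X_n] and [X] ([gh_dist_cone_le]).

The null distance is at least the maximum.  The null length of a piecewise
causal curve dominates the time difference by the triangle inequality.  On a
causal piece the metric derivative of the spatial part is almost everywhere at
most the absolute value of the derivative of the time part, which has constant
sign; the fundamental theorem of calculus for absolutely continuous curves then
bounds the spatial distance travelled by the time elapsed.  The form of that
theorem needed here is [mdist_le_increment]: an almost everywhere inequality
between a metric derivative and a derivative integrates to an inequality
between increments.  The exceptional null set is covered by an open set of
small measure; a Cousin-type subdivision [gauge_subdivision] makes each
subinterval either satisfy the inequality up to a small error, or lie in that
open set, where absolute continuity makes the total contribution small.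

The null distance is at most the maximum.  Let [M > 0] be the maximum and run a
geodesic from [x] to [y] at constant speed on [[0, M]]; its speed is at most
1, so it becomes causal as soon as the time coordinate moves at speed 1 in
either direction, and the resulting null length is then exactly [M].  If the
time difference is [M], the time coordinate goes straight.  Otherwise there is
time to waste, and it zigzags inside [[c, d]] with slopes 1 and -1
([zigzag_exists]); this is where [c < d] is used.  Geodesics exist by
compactness ([geodesic]): they are pointwise ultralimits of almost shortest
curves reparametrized by the distance to their origin. *)

(** * The maximum metric on a product, and cones over isometric embeddings *)

Section MaxMetric.
Context {R : realType} (Z : metricType R).
Implicit Types p q : (R^o * Z)%type.

Let max_dist p q : R := Num.max (mdist p.1 q.1) (mdist p.2 q.2).

Let max_dist_ge0 p q : 0 <= max_dist p q.
Proof. by rewrite le_max !mdist_ge0. Qed.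

Let max_dist_positivity p q : max_dist p q = 0 -> p = q.
Proof.
case: p q => [s x] [t y] pq0.
have : max_dist (s, x) (t, y) <= 0 by rewrite pq0.
rewrite ge_max/= => /andP[st0 xy0]; congr pair.
  by apply: mdist_positivity; apply/eqP; rewrite eq_le st0 mdist_ge0.
by apply: mdist_positivity; apply/eqP; rewrite eq_le xy0 mdist_ge0.
Qed.

Let ballEmax_dist p (e : R) : ball p e = [set q | max_dist p q < e].
Proof.
apply/seteqP; split => q; rewrite /max_dist/= gt_max.
  by case; rewrite !ballEmdist/= => -> ->.
by move=> /andP[? ?]; split; rewrite ballEmdist.
Qed.

(* The balls of the product pseudometric are already products of balls, so the
   maximum metric is compatible with the existing structure. *)
HB.instance Definition _ := @PseudoMetric_isMetric.Build R (R^o * Z)%type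
  max_dist max_dist_ge0 max_dist_positivity ballEmax_dist.

End MaxMetric.

Section ConeConvergence.
Context {R : realType}.

Lemma hausdorff_dist_ge0 (Z : metricType R) (A B : set Z) :
  (0 <= hausdorff_dist A B)%E.
Proof. by apply: le_ereal_inf_tmp => _ [r [r0 _ _] <-]; rewrite lee_fin ltW. Qed.

Lemma gh_dist_ge0 (S T : Type) (dS : S -> S -> \bar R) (dT : T -> T -> \bar R) :
  (0 <= gh_dist dS dT)%E.
Proof.
by apply: le_ereal_inf_tmp => _ [Z [phi [psi [_ _ ->]]]]; exact: hausdorff_dist_ge0.
Qed.

(** For [I = [c, d]] and [X] a compact length space this is the null distance of
the cone, see [null_distE]. *)
Definition max_cone_dist {I : set R} {X : metricType R} (p q : gen_cone I X) :=
  (Num.max `|time q - time p| (mdist p.2 q.2))%:E.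

Definition cone_map {I : set R} {X Z : metricType R} (phi : X -> Z)
  (p : gen_cone I X) : (R^o * Z)%type := (time p, phi p.2).

Lemma cone_eq (I : set R) (X : metricType R) (p q : gen_cone I X) :
  time p = time q -> p.2 = q.2 -> p = q.
Proof. by case: p q => [s x] [t y] /val_inj/= -> /= ->. Qed.

Lemma isometric_cone_map (I : set R) (X : metricType R) (Z : metricType R)
    (phi : X -> Z) :
  isometric_embedding (@dist_of R X) phi ->
  isometric_embedding (@max_cone_dist I X) (cone_map phi).
Proof.
move=> [phi_inj phi_iso]; split=> [p q [pq /phi_inj]|[s x] [t y]]; first exact: cone_eq.
congr (_%:E); rewrite [LHS]/mdist/=; congr Num.max.
by have := phi_iso x y; rewrite /dist_of => -[].
Qed.

(** A point of the cone is moved along its fibre of constant time, so only the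
distance in [Z] matters. *)
Lemma range_cone_mapS (I : set R) (X Y : metricType R) (Z : metricType R)
    (phi : X -> Z) (psi : Y -> Z) (r : R) : 0 < r ->
  range phi `<=` \bigcup_(z in range psi) ball z r ->
  range (@cone_map I X Z phi) `<=`
    \bigcup_(z in range (@cone_map I Y Z psi)) ball z r.
Proof.
move=> r0 near_psi _ [[s x] _ <-].
have [_ [y _ <-] yx] := near_psi (phi x) (imageT _ _).
exists (cone_map psi ((s, y) : gen_cone I Y)); first exact: imageT.
by split => //=; exact: ballxx.
Qed.

Lemma gh_dist_cone_le (I : set R) (X Y : metricType R) :
  (gh_dist (@max_cone_dist I X) (@max_cone_dist I Y)
   <= gh_dist (@dist_of R X) (@dist_of R Y))%E.
Proof.
apply: le_ereal_inf_tmp => _ [Z [phi [psi [phi_iso psi_iso ->]]]].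
apply: le_ereal_inf_tmp => _ [r [r0 XY YX] <-].
apply: le_trans (_ : (hausdorff_dist (range (@cone_map I X Z phi))
                          (range (@cone_map I Y Z psi)) <= _)%E); last first.
  by apply: ereal_inf_lbound; exists r => //; split=> //; exact: range_cone_mapS.
apply: ereal_inf_lbound; exists (R^o * Z)%type, (cone_map phi), (cone_map psi).
by split=> //; exact: isometric_cone_map.
Qed.

Lemma gh_cvg_cone (I : set R) (X_ : nat -> metricType R) (X : metricType R) :
  gh_cvg (fun n => @dist_of R (X_ n)) (@dist_of R X) ->
  gh_cvg (fun n => @max_cone_dist I (X_ n)) (@max_cone_dist I X).
Proof.
apply: squeeze_cvge; last exact: cvg_cst.
by apply: nearW => n; rewrite gh_dist_ge0/=; exact: gh_dist_cone_le.
Qed.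

End ConeConvergence.

(** * From almost everywhere bounds on derivatives to bounds on increments *)

Section GaugeSubdivision.
Context {R : realType}.

(** Cousin's lemma, for intervals containing their tag.  The supremum of the
points up to which a subdivision exists is itself such a point, and cannot be
smaller than [b], because the gauge at the supremum allows one more step. *)
Lemma gauge_subdivision (a b : R) (Q : R -> R -> Prop) : a <= b ->
  (forall s, a <= s <= b -> exists2 eta, 0 < eta &
    forall u v, a <= u -> u <= s -> s <= v -> v <= b -> v - u < eta -> Q u v) ->
  exists n (x : nat -> R), [/\ x 0%N = a, x n = b, nondecreasing_seq x
    & forall i, (i < n)%N -> Q (x i) (x i.+1)].
Proof.
move=> ab gauge.
pose subdivided t := exists n (x : nat -> R), [/\ x 0%N = a, x n = t,
  nondecreasing_seq x & forall i, (i < n)%N -> Q (x i) (x i.+1)].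
pose S := [set t | a <= t <= b /\ subdivided t].
have Sa : S a.
  split; first by rewrite lexx.
  by exists 0%N, (cst a); split.
have S_sup : has_sup S.
  by split; [exists a|exists b => t [/andP[]]].
have sup_ab : a <= sup S <= b.
  apply/andP; split; first exact: sup_upper_bound.
  by apply: ge_sup; [exists a|move=> t [/andP[]]].
have [eta eta0 Qeta] := gauge _ sup_ab.
have [t [/andP[at_ tb] [n [x [x0 xn x_nd Qx]]]] t_sup] :=
  sup_adherent (divr_gt0 eta0 (ltr0n _ 2)) S_sup.
have t_le : t <= sup S.
  by apply: sup_upper_bound => //; split; [rewrite at_|exists n, x].
pose v := Num.min b (sup S + eta / 4).
have [vb v_eta] : v <= b /\ v <= sup S + eta / 4.
  by rewrite /v !ge_min !lexx orbT.
have sup_v : sup S <= v.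
  by rewrite /v le_min; apply/andP; split; [case/andP: sup_ab|lra].
have Sv : S v.
  split; first by rewrite vb andbT; lra.
  exists n.+1, (fun i => if (i <= n)%N then x i else v); split => //.
  - by rewrite ltnn.
  - apply/nondecreasing_seqP => i.
    have [i_n|] := ltnP i n; first by rewrite ltnW// x_nd.
    rewrite leq_eqVlt => /predU1P[<-|n_i]; first by rewrite leqnn xn; lra.
    by rewrite leqNgt n_i.
  - move=> i; rewrite ltnS => i_le; rewrite i_le; case: ifP => [/Qx//|i_n].
    rewrite (_ : i = n) ?xn; last by apply/eqP; rewrite eqn_leq i_le leqNgt i_n.
    by apply: Qeta => //; lra.
have v_sup : v <= sup S by exact: sup_upper_bound.
suff <- : v = b by case: Sv.
by move: v_sup; rewrite /v; have [//|_] := leP b (sup S + eta / 4); lra.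
Qed.

End GaugeSubdivision.

Section AbsolutelyContinuousCurves.
Context {R : realType}.
Local Notation mu := (@lebesgue_measure R).

Lemma sum_itv_le_measure (U : set R) n (u v : nat -> R) : open U ->
  (forall i, (i < n)%N -> u i <= v i) ->
  (forall i, (i < n)%N -> `]u i, v i[%classic `<=` U) ->
  trivIset `I_n (fun i => `]u i, v i[%classic) ->
  ((\sum_(i < n) (v i - u i))%:E <= mu U)%E.
Proof.
move=> openU uv uvU tuv.
have -> : (\sum_(i < n) (v i - u i))%:E = (\sum_(i < n) mu `]u i, v i[%classic)%E.
  rewrite -sumEFin; apply: eq_bigr => i _.
  rewrite lebesgue_measure_itv/= lte_fin.
  case: ifPn => [_ //|]; rewrite -leNgt => vu.
  by rewrite (_ : v i = u i) ?subrr//; apply/eqP; rewrite eq_le vu uv.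
rewrite -(@measure_semi_additive_ord_I _ _ _ mu (fun i => `]u i, v i[%classic))//.
- apply: le_measure; rewrite ?inE.
  + by apply: bigsetU_measurable => i _; exact: measurable_itv.
  + exact: open_measurable.
  + rewrite -(bigcup_mkord n (fun i => `]u i, v i[%classic)).
    by move=> y [i /= i_n uiv]; exact: (uvU i).
- by apply: bigsetU_measurable => i _; exact: measurable_itv.
Qed.

Lemma dnbhs0_near (s : R) (P : R -> Prop) :
  (\forall h \near 0^', P h) -> \forall t \near s, t != s -> P (t - s).
Proof.
rewrite near_withinE => /nbhs_ballP[e /= e0 Pe]; apply/nbhs_ballP; exists e => //.
move=> t /= st ts; apply: Pe; last by rewrite subr_eq0.
by move: st; rewrite /ball/= sub0r normrN distrC.
Qed.

Lemma metric_derivative_upper {X : metricType R} (beta : R -> X) s v e :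
  is_metric_derivative beta s v -> 0 < e ->
  \forall t \near s, mdist (beta s) (beta t) <= (v + e) * `|t - s|.
Proof.
move=> /cvgrPdist_le beta_v e0; apply: filterS (dnbhs0_near s _ (beta_v _ e0)).
move=> t; have [->|ts /(_ isT)] := eqVneq t s.
  by rewrite mdistxx subrr normr0 mulr0.
rewrite [s + _]addrC subrK distrC => /(le_trans (ler_norm _)).
by rewrite lerBlDl ler_pdivrMr// normr_gt0 subr_eq0.
Qed.

Lemma derive1_approx (alpha : R -> R) s e :
  derivable alpha s 1 -> 0 < e ->
  \forall t \near s, `|alpha t - alpha s - derive1 alpha s * (t - s)|
      <= e * `|t - s|.
Proof.
move=> alpha_s e0; have alpha' : h^-1 *: (alpha (h + s) - alpha s) @[h --> 0^']
    --> derive1 alpha s.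
  rewrite derive1E; move: alpha_s; rewrite /derivable /derive /=.
  by under eq_fun do rewrite -[_%:A]/(_ * 1) mulr1.
move/cvgrPdist_le : alpha' => alpha'.
apply: filterS (dnbhs0_near s _ (alpha' _ e0)) => t.
have [->|ts /(_ isT)] := eqVneq t s.
  by rewrite !subrr mulr0 subr0 normr0 mulr0.
rewrite subrK -ler_pdivrMr ?normr_gt0 ?subr_eq0// distrC.
rewrite -normfV -normrM mulrBl mulfK ?subr_eq0// => H.
by rewrite (le_trans _ H)// [X in _ <= `|X - _|]mulrC.
Qed.

(** Off a null set the hypothesis gives a local inequality with an error
proportional to the length, and these errors add up to a multiple of
[b - a].  The null set, together with the two endpoints, is covered by an open
set [U] of small measure; the intervals of the subdivision contained in [U]
contribute little by absolute continuity of both curves. *)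
Lemma mdist_le_increment {X : metricType R} (a b : R) (alpha : R -> R)
    (beta : R -> X) : a <= b ->
  @abs_continuous R R^o a b alpha -> abs_continuous a b beta ->
  {ae mu, forall s, s \in `]a, b[ -> derivable alpha s 1 /\
     exists2 v, is_metric_derivative beta s v & v <= derive1 alpha s} ->
  mdist (beta a) (beta b) <= alpha b - alpha a.
Proof.
move=> ab alpha_ac beta_ac [N [mN N0 subN]].
apply/ler_addgt0Pr => e e0.
(* The error is e1 for each of the two absolute continuity estimates, plus
   2 e1 (b - a) for the intervals controlled by the derivatives. *)
pose e1 := e / (2 * (b - a) + 2).
have ba0 : 0 <= b - a by rewrite subr_ge0.
have e10 : 0 < e1 by rewrite divr_gt0// ltr_wpDl// mulr_ge0.
have [d1 d10 alphaP] := alpha_ac _ e10.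
have [d2 d20 betaP] := beta_ac _ e10.
pose d := Num.min d1 d2.
have d0 : 0 < d by rewrite lt_min d10.
have [dd1 dd2] : d <= d1 /\ d <= d2 by rewrite /d !ge_min !lexx orbT.
pose D := N `|` [set a] `|` [set b].
have mD : measurable D by do 2 apply: measurableU => //.
have D0 : mu D = 0%E.
  by rewrite /D !measureU0//; [exact: lebesgue_measure_set1|exact: measurableU
    |exact: lebesgue_measure_set1].
have [U [openU DU UD]] : exists U, [/\ open U, D `<=` U & (mu U < d%:E)%E].
  have [|U [openU DU UD]] := @lebesgue_regularity_outer R D d mD _ d0.
    by rewrite [ltLHS]D0.
  exists U; split => //; rewrite -(setDUK DU).
  have mU := open_measurable openU.
  apply: le_lt_trans (measureU2 _ mD (measurableD mU mD)) _.
  by rewrite [X in (X + _)%E]D0 add0e.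
pose Q u v := mdist (beta u) (beta v) <= alpha v - alpha u + 2 * e1 * (v - u)
  \/ `]u, v[%classic `<=` U.
have [s sab|n [x [x0 xn x_nd Qx]]] := gauge_subdivision a b Q ab.
  have [Us|nUs] := pselect (U s).
    have /nbhs_ballP[eta /= eta0 sU] : nbhs s U by exact: open_nbhs_nbhs.
    exists eta => // u v au us sv vb vu; right => t /=; rewrite in_itv/= => /andP[ut tv].
    by apply: sU => /=; rewrite /ball/= ltr_norml; apply/andP; split; lra.
  have s_ab : s \in `]a, b[.
    rewrite in_itv/= !lt_neqAle; case/andP: sab => -> ->; rewrite !andbT.
    apply/andP; split; apply/eqP => sE; apply: nUs; apply: DU; rewrite /D/= sE; tauto.
  have [alpha_s [v beta_s v_le]] : derivable alpha s 1 /\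
     exists2 v, is_metric_derivative beta s v & v <= derive1 alpha s.
    by apply: contrapT => nP; apply: nUs; apply: DU; left; left; apply: subN => /(_ s_ab).
  have /nbhs_ballP[eta /= eta0 approx] : \forall t \near s,
      mdist (beta s) (beta t) <= (v + e1) * `|t - s| /\
      `|alpha t - alpha s - derive1 alpha s * (t - s)| <= e1 * `|t - s|.
    by apply: filterI; [exact: metric_derivative_upper|exact: derive1_approx].
  exists eta => // u w au us sw wb wu; left.
  have [|betau alphau] := approx u; first by rewrite /ball/= ger0_norm; lra.
  have [|betaw alphaw] := approx w; first by rewrite /ball/= ler0_norm; lra.
  rewrite (le_trans (metric_triangle _ (beta s) _))// metric_sym.
  move: betau alphau betaw alphaw; rewrite !ler_norml.
  rewrite [`|u - s|]ler0_norm ?[`|w - s|]ger0_norm ?subr_le0 ?subr_ge0//.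
  move=> betau /andP[_ alphau] betaw /andP[alphaw _].
  have : (v + e1) * (w - u) <= (derive1 alpha s + e1) * (w - u).
    by rewrite ler_wpM2r ?lerD2r// subr_ge0; lra.
  lra.
(* Intervals outside U are replaced by empty ones, so that absolute continuity
   can be applied to a family indexed by all the subintervals. *)
pose y i := if `[< `]x i, x i.+1[%classic `<=` U >] then x i.+1 else x i.
have x_ab i : (i <= n)%N -> a <= x i <= b.
  by move=> i_n; rewrite -x0 -xn !x_nd.
have xy i : x i <= y i by rewrite /y; case: ifP => // _; exact/x_nd/leqnSn.
have yx i : y i <= x i.+1 by rewrite /y; case: ifP => // _; exact/x_nd/leqnSn.
have xyU i : `]x i, y i[%classic `<=` U.
  rewrite /y; case: ifPn => [/asboolP//|_] t /=; rewrite in_itv/= => /andP[xt tx].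
  by have := lt_trans xt tx; rewrite ltxx.
have xy_ab i : (i < n)%N -> a <= x i /\ x i <= y i /\ y i <= b.
  move=> i_n; have /andP[-> _] := x_ab _ (ltnW i_n); split => //; split => //.
  by rewrite (le_trans (yx i))//; have /andP[] := x_ab _ i_n.
have t_xy : trivIset `I_n (fun i => `]x i, y i[%classic).
  apply: sub_trivIset (@subsetT _ _) _; apply: ltn_trivIset => j i ij.
  apply/seteqP; split => // t [/=].
  rewrite !in_itv/= => /andP[_ ty] /andP[xj _].
  have := lt_le_trans (lt_le_trans (lt_trans xj ty) (yx i)) (x_nd _ _ ij).
  by rewrite ltxx.
have sum_xy : \sum_(i < n) (y i - x i) < d.
  by rewrite -lte_fin (le_lt_trans _ UD)//; exact: sum_itv_le_measure.
have alpha_xy := alphaP n x y xy_ab t_xy (lt_le_trans sum_xy dd1).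
have beta_xy := betaP n x y xy_ab t_xy (lt_le_trans sum_xy dd2).
have chain : mdist (beta a) (beta b) <= \sum_(i < n) mdist (beta (x i)) (beta (x i.+1)).
  rewrite -x0 -xn; elim: n {Qx xn x_ab xy_ab t_xy sum_xy alpha_xy beta_xy} => [|n ih].
    by rewrite mdistxx big_ord0.
  by rewrite big_ord_recr/= (le_trans (metric_triangle _ (beta (x n)) _))// lerD2r.
rewrite (le_trans chain)//.
have : \sum_(i < n) mdist (beta (x i)) (beta (x i.+1)) <=
  \sum_(i < n) ((alpha (x i.+1) - alpha (x i)) + 2 * e1 * (x i.+1 - x i)
    + mdist (beta (x i)) (beta (y i)) + `|alpha (y i) - alpha (x i)|).
  apply: ler_sum => i _; rewrite /y; case: ifPn => [_|/asboolPn nU].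
    have := ler_norm (- (alpha (x i.+1) - alpha (x i))); rewrite normrN.
    have : 0 <= 2 * e1 * (x i.+1 - x i).
      by rewrite mulr_ge0 ?subr_ge0 ?x_nd ?leqnSn// mulr_ge0// ltW.
    lra.
  by have [|//] := Qx i (ltn_ord i); rewrite mdistxx subrr normr0 !addr0.
move/le_trans; apply.
rewrite 3!big_split/= -mulr_sumr.
have telescope (g : R -> R) : \sum_(i < n) (g (x i.+1) - g (x i)) = g b - g a.
  by rewrite -(big_mkord xpredT (fun i => g (x i.+1) - g (x i))) telescope_sumr// x0 xn.
rewrite telescope (telescope id).
have e1E : 2 * e1 * (b - a) + e1 + e1 = e.
  rewrite /e1; field.
  by rewrite gt_eqF//; lra.
have : \sum_(i < n) `|alpha (y i) - alpha (x i)| < e1 by exact: alpha_xy.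
lra.
Qed.

End AbsolutelyContinuousCurves.

(** * Geodesics in compact length spaces *)

Section Geodesics.
Context {R : realType} {X : metricType R}.
Implicit Types (a b s t u v : R) (x y z : X) (gamma : R -> X).

Lemma curve_length_ge1 a b gamma : a < b ->
  ((mdist (gamma a) (gamma b))%:E <= curve_length a b gamma)%E.
Proof.
move=> ab; apply: ereal_sup_ubound; exists [:: b]; first exact: itv_partition1.
by rewrite big_ord1.
Qed.

Lemma curve_length_ge2 a b u gamma : a < b -> a <= u -> u <= b ->
  ((mdist (gamma a) (gamma u) + mdist (gamma u) (gamma b))%:E
    <= curve_length a b gamma)%E.
Proof.
move=> ab; rewrite le_eqVlt => /predU1P[<- _|au].
  by rewrite mdistxx add0r; exact: curve_length_ge1.
rewrite le_eqVlt => /predU1P[->|ub].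
  by rewrite mdistxx addr0; exact: curve_length_ge1.
apply: ereal_sup_ubound; exists [:: u; b]; first by split; rewrite /= ?eqxx// au ub.
by rewrite !big_ord_recl big_ord0/= addr0.
Qed.

Lemma curve_length_ge3 a b u v gamma : a < b -> a <= u -> u <= v -> v <= b ->
  ((mdist (gamma a) (gamma u) + mdist (gamma u) (gamma v) +
    mdist (gamma v) (gamma b))%:E <= curve_length a b gamma)%E.
Proof.
move=> ab; rewrite le_eqVlt => /predU1P[<- av vb|au].
  by rewrite mdistxx add0r; exact: curve_length_ge2.
rewrite le_eqVlt => /predU1P[<- ub|uv].
  by rewrite mdistxx addr0; apply: curve_length_ge2 => //; exact: ltW.
rewrite le_eqVlt => /predU1P[vb|vb].
  rewrite -vb mdistxx addr0; apply: curve_length_ge2; [|exact: ltW..].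
  by rewrite vb.
apply: ereal_sup_ubound; exists [:: u; v; b]; first by split; rewrite /= ?eqxx// au uv vb.
by rewrite !big_ord_recl big_ord0/= addr0 addrA.
Qed.

Lemma mdist_lipschitz x y z : `|mdist x z - mdist x y| <= mdist y z.
Proof.
have := metric_triangle x y z; have := metric_triangle x z y.
by rewrite (metric_sym z) ler_norml => ? ?; apply/andP; split; lra.
Qed.

(** On a curve whose length exceeds the distance of its endpoints by less than
[e], the distance to the origin is within [e] of an arc length parameter; by the
intermediate value theorem it takes all values between 0 and [mdist x y], so
[beta s] can be chosen to be any point of the curve at distance [s] from [x].
The function [beta] need not be continuous. *)
Lemma almost_geodesic x y e : length_space X -> 0 < e -> exists beta : R -> X,
  [/\ beta 0 = x, mdist (beta (mdist x y)) y <= e &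
    forall s t, s \in `[0, mdist x y] -> t \in `[0, mdist x y] ->
      mdist (beta s) (beta t) <= `|s - t| + e].
Proof.
move=> lengthX e0.
have [_ [a [b [gamma [ab gamma_c gamma_a gamma_b ->]]]]] :
    exists2 l, [set l | exists a b (beta : R -> X),
      [/\ a < b, {within `[a, b], continuous beta}, beta a = x, beta b = y
        & l = curve_length a b beta]] l & (l < (mdist x y + e)%:E)%E.
  apply: ereal_inf_lt; rewrite -lengthX lte_fin; lra.
move=> gamma_short.
have gamma_dist u v : a <= u -> u <= v -> v <= b ->
    mdist (gamma u) (gamma v) <= mdist x (gamma v) - mdist x (gamma u) + e.
  move=> au uv vb.
  have := le_lt_trans (curve_length_ge3 _ _ _ _ gamma ab au uv vb) gamma_short.
  rewrite lte_fin gamma_a gamma_b.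
  have := metric_triangle x (gamma v) y; lra.
have dist_c : {within `[a, b], continuous (fun t => mdist x (gamma t))}.
  move=> t; apply/(@metricType_numDomainType.cvgrPdist_lt _ R^o) => /= d d0.
  have /metricType_numDomainType.cvgrPdist_lt/(_ _ d0) := gamma_c t.
  apply: filterS => u; apply: le_lt_trans.
  exact: (mdist_lipschitz x (gamma t) (gamma u)).
have tau_ s : exists u, s \in `[0, mdist x y] -> u \in `[a, b] /\ mdist x (gamma u) = s.
  have [s_xy|] := boolP (s \in `[0, mdist x y]); last by exists 0.
  have [|u uab us] := IVT (ltW ab) dist_c (v := s).
    by rewrite gamma_a gamma_b mdistxx min_l ?mdist_ge0// max_r ?mdist_ge0.
  by exists u.
have [tau tauP] := choice tau_.
exists (gamma \o tau); split.
- apply/esym/mdist_positivity; apply: (tauP 0 _).2.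
  by rewrite in_itv/= lexx mdist_ge0.
- have [|tau_ab tau_d] := tauP (mdist x y); first by rewrite in_itv/= lexx mdist_ge0.
  move: tau_ab; rewrite in_itv/= => /andP[a_tau tau_b].
  have := gamma_dist _ _ a_tau tau_b (lexx b).
  by rewrite tau_d gamma_b subrr add0r.
- move=> s t /tauP[s_ab s_d] /tauP[t_ab t_d] /=.
  move: s_ab t_ab; rewrite !in_itv/= => /andP[a_s s_b] /andP[a_t t_b].
  have [st|/ltW ts] := leP (tau s) (tau t).
    apply: le_trans (gamma_dist _ _ a_s st t_b) _.
    by rewrite s_d t_d lerD2r distrC; exact: ler_norm.
  rewrite metric_sym; apply: le_trans (gamma_dist _ _ a_t ts s_b) _.
  by rewrite s_d t_d lerD2r; exact: ler_norm.
Qed.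

(** An ultrafilter on the indices makes all the sequences of points of the
almost geodesics converge at once, and the limit is 1-Lipschitz.  Since its
endpoints are at distance [mdist x y], it is an isometric embedding. *)
Lemma geodesic x y : compact [set: X] -> length_space X -> exists beta : R -> X,
  [/\ beta 0 = x, beta (mdist x y) = y &
    forall s t, s \in `[0, mdist x y] -> t \in `[0, mdist x y] ->
      mdist (beta s) (beta t) = `|s - t|].
Proof.
move=> compactX lengthX.
have [approx approxP] := choice (fun n : nat =>
  almost_geodesic x y (n.+1%:R^-1) lengthX (ltac:(by []))).
have [G [GU oo_G]] := ultraFilterLemma (F := nbhs \oo) _.
have Gproper : ProperFilter G by exact: ultra_proper.
have beta_ s : exists p : X, approx n s @[n --> G] --> p.
  have [p [_ clusterp]] := compactX (approx n s @[n --> G]) _ filterT.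
  exists p => A /= nbhsA.
  have [//|GnA] := in_ultra_setVsetC (approx ^~ s @^-1` A) GU.
  by have [q []] := clusterp (~` A) A GnA nbhsA.
have [beta betaP] := choice beta_.
have limit_le s t d : (forall n, mdist (approx n s) (approx n t) <= d + n.+1%:R^-1) ->
    mdist (beta s) (beta t) <= d.
  move=> approx_le; apply/ler_addgt0Pr => e e0; have e3 : 0 < e / 3 by rewrite divr_gt0.
  have /metricType_numDomainType.cvgrPdist_lt/(_ _ e3) close_s := betaP s.
  have /metricType_numDomainType.cvgrPdist_lt/(_ _ e3) close_t := betaP t.
  have small : \forall n \near G, n.+1%:R^-1 < e / 3.
    by apply: oo_G; exact: near_infty_natSinv_lt (PosNum e3).
  have [n [[ns nt] n3]] := filter_ex (filterI (filterI close_s close_t) small).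
  have := metric_triangle (beta s) (approx n s) (beta t).
  have := metric_triangle (approx n s) (approx n t) (beta t).
  have := metric_sym (beta t) (approx n t).
  have := approx_le n; move: ns nt n3 => /=; move: n.+1%:R^-1 => k; lra.
have limit_eq s z : (forall n, mdist (approx n s) z <= n.+1%:R^-1) -> beta s = z.
  move=> approx_le; apply: mdist_positivity; apply/eqP; rewrite eq_le mdist_ge0 andbT.
  apply/ler_addgt0Pr => e e0; have e2 : 0 < e / 2 by rewrite divr_gt0.
  have /metricType_numDomainType.cvgrPdist_lt/(_ _ e2) close_s := betaP s.
  have small : \forall n \near G, n.+1%:R^-1 < e / 2.
    by apply: oo_G; exact: near_infty_natSinv_lt (PosNum e2).
  have [n [ns n2]] := filter_ex (filterI close_s small).
  have := metric_triangle (beta s) (approx n s) z.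
  have := approx_le n; move: ns n2 => /=; move: n.+1%:R^-1 => k; lra.
have beta0 : beta 0 = x.
  by apply: limit_eq => n; have [-> _ _] := approxP n; rewrite mdistxx.
have betaL : beta (mdist x y) = y.
  by apply: limit_eq => n; have [_ + _] := approxP n.
have beta_le s t : s \in `[0, mdist x y] -> t \in `[0, mdist x y] ->
    mdist (beta s) (beta t) <= `|s - t|.
  by move=> s_xy t_xy; apply: limit_le => n; have [_ _] := approxP n; exact.
exists beta; split => //.
have beta_eq s t : s \in `[0, mdist x y] -> t \in `[0, mdist x y] -> s <= t ->
    mdist (beta s) (beta t) = t - s.
  move=> s_xy t_xy st; apply/eqP; rewrite eq_le; apply/andP; split.
    by rewrite (le_trans (beta_le _ _ s_xy t_xy))// distrC ger0_norm ?subr_ge0.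
  move: (s_xy) (t_xy); rewrite !in_itv/= => /andP[? ?] /andP[? ?].
  have := beta_le 0 s; rewrite beta0 sub0r normrN (ger0_norm (x := s))//.
  have := beta_le t (mdist x y); rewrite betaL distrC.
  rewrite (ger0_norm (x := _ - t)) ?subr_ge0//.
  rewrite s_xy t_xy !in_itv/= !lexx mdist_ge0/= => /(_ isT isT) ty /(_ isT isT) xs.
  have := metric_triangle x (beta s) y; have := metric_triangle (beta s) (beta t) y.
  lra.
move=> s t s_xy t_xy; have [st|ts] := leP s t.
  by rewrite beta_eq// distrC ger0_norm ?subr_ge0.
by rewrite metric_sym beta_eq ?(ltW ts)// gtr0_norm ?subr_gt0.
Qed.

End Geodesics.

(** * The lower bound for the null distance *)

Section NullDistanceLowerBound.
Context {R : realType} {I : set R} {X : metricType R}.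
Implicit Types (a b l r : R) (gamma : R -> gen_cone I X) (p q : gen_cone I X).

Lemma future_causal_mdist_le l r gamma : l <= r ->
  future_causal (cst 1) l r gamma ->
  mdist (gamma l).2 (gamma r).2 <= time (gamma r) - time (gamma l).
Proof.
move=> lr [[alpha_ac beta_ac _ causal_ae] future_ae].
refine (@mdist_le_increment R X l r (@time R I X \o gamma) (fun s => (gamma s).2)
  lr alpha_ac beta_ac _).
have ae_filter := ae_filter_ringOfSetsType (@lebesgue_measure R).
apply: filterS2 causal_ae future_ae => s causal_s future_s slr.
have [alpha_s [v beta_s vle]] := causal_s slr; split=> //; exists v => //.
have alpha'0 := future_s slr; rewrite leNgt; apply/negP => lt_v.
by move: vle; rewrite expr1n mul1r addrC subr_le0 leNgt ltr_pXn2r// ?nnegrE; lra.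
Qed.

Lemma past_causal_mdist_le l r gamma : l <= r ->
  past_causal (cst 1) l r gamma ->
  mdist (gamma l).2 (gamma r).2 <= time (gamma l) - time (gamma r).
Proof.
move=> lr [[alpha_ac beta_ac _ causal_ae] past_ae].
have alphaN_ac : @abs_continuous R R^o l r (fun s => - time (gamma s)).
  move=> e e0; have [d d0 dP] := alpha_ac _ e0; exists d => // n u v uv tuv uvd.
  rewrite (le_lt_trans _ (dP n u v uv tuv uvd))//; apply: ler_sum => i _.
  by rewrite /mdist/= opprK addrC distrC.
rewrite (_ : time (gamma l) - _ = - time (gamma r) - - time (gamma l)); last first.
  by rewrite opprK addrC.
refine (@mdist_le_increment R X l r (fun s => - time (gamma s)) (fun s => (gamma s).2)
  lr alphaN_ac beta_ac _).
have ae_filter := ae_filter_ringOfSetsType (@lebesgue_measure R).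
apply: filterS2 causal_ae past_ae => s causal_s past_s slr.
have [alpha_s [v beta_s vle]] := causal_s slr; split; first exact: derivableN.
exists v => //; have alpha'0 := past_s slr.
rewrite derive1E deriveN// -derive1E leNgt; apply/negP => lt_v.
move: vle; rewrite expr1n mul1r addrC subr_le0 leNgt -sqrrN.
by rewrite ltr_pXn2r// ?nnegrE; lra.
Qed.

(** Each piece, causal or constant, travels in [X] at most the distance that it
travels in time, whatever its direction. *)
Lemma max_cone_dist_le_null_length a b s gamma :
  piecewise_causal (cst 1) a b s gamma ->
  Num.max `|time (gamma b) - time (gamma a)| (mdist (gamma a).2 (gamma b).2)
    <= null_length a b s gamma.
Proof.
move=> [abs pieces]; pose x i := nth b (a :: s) i.
have x0 : x 0%N = a by [].
have xn : x (size s) = b by exact: (itv_partition_nth_size b abs).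
have x_le i : (i < size s)%N -> x i <= x i.+1.
  move=> i_s; have [path_s _] := abs.
  by rewrite ltW//; exact: (pathP b path_s).
have step i : (i < size s)%N ->
    mdist (gamma (x i)).2 (gamma (x i.+1)).2 <=
    `|time (gamma (x i.+1)) - time (gamma (x i))|.
  move=> i_s; have lr := x_le _ i_s; case: (pieces _ i_s) => [[y y_const]|fut|past].
  - by rewrite !y_const ?in_itv/= ?lexx ?lr// mdistxx.
  - exact: le_trans (future_causal_mdist_le _ _ _ lr fut) (ler_norm _).
  - rewrite distrC; exact: le_trans (past_causal_mdist_le _ _ _ lr past) (ler_norm _).
suff le_sum n : (n <= size s)%N ->
    Num.max `|time (gamma (x n)) - time (gamma (x 0%N))|
      (mdist (gamma (x 0%N)).2 (gamma (x n)).2)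
    <= \sum_(i < n) `|time (gamma (x i.+1)) - time (gamma (x i))|.
  by have := le_sum _ (leqnn _); rewrite xn.
elim: n => [_|n ih n_s]; first by rewrite subrr normr0 mdistxx big_ord0 maxxx.
move: (ih (ltnW n_s)); rewrite big_ord_recr/= !ge_max => /andP[ih1 ih2].
apply/andP; split.
  by rewrite (le_trans (ler_distD (time (gamma (x n))) _ _))// addrC lerD.
by rewrite (le_trans (metric_triangle _ (gamma (x n)).2 _))// lerD// step.
Qed.

Lemma max_cone_dist_le_null_dist p q :
  (max_cone_dist p q <= null_dist (cst 1%R) p q)%E.
Proof.
apply: le_ereal_inf_tmp => _ [a [b [s [gamma [ab pc <- <- ->]]]]].
by rewrite lee_fin; exact: max_cone_dist_le_null_length.
Qed.

End NullDistanceLowerBound.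

(** * Causal pieces whose time coordinate has unit speed *)

Section UnitSpeedPieces.
Context {R : realType}.

Lemma lipschitz_abs_continuous {Y : metricType R} (a b : R) (beta : R -> Y) :
  {in `[a, b] &, forall s t, mdist (beta s) (beta t) <= `|s - t|} ->
  abs_continuous a b beta.
Proof.
move=> beta_lip e e0; exists e => // n u v uv _ uve.
apply: le_lt_trans uve; apply: ler_sum => i _.
have [au [uv_i vb]] := uv _ (ltn_ord i).
rewrite (le_trans (beta_lip _ _ _ _)) ?in_itv/= ?au ?vb ?(le_trans uv_i) ?(le_trans au)//.
by rewrite distrC ger0_norm ?subr_ge0.
Qed.

Definition unit_slope (alpha : R -> R) (l r : R) : Prop :=
  exists2 e : R, e = 1 \/ e = -1 &
    forall s, l <= s <= r -> alpha s = alpha l + e * (s - l).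

Lemma unit_slope_causal {I : set R} {X : metricType R} (l r k : R)
    (gamma : R -> gen_cone I X) : 0 <= k <= 1 ->
  unit_slope (fun s => time (gamma s)) l r ->
  {in `[l, r] &, forall s t, mdist (gamma s).2 (gamma t).2 = k * `|s - t|} ->
  future_causal (cst 1) l r gamma \/ past_causal (cst 1) l r gamma.
Proof.
move=> /andP[k0 k1] [e e1 timeE] speed.
have slope s : s \in `]l, r[ -> is_derive s 1 (@time R I X \o gamma) e.
  move=> slr; apply: (@near_eq_is_derive _ _ _ (fun x => time (gamma l) + e * (x - l))).
    have : \forall x \near s, x \in `]l, r[ by exact: near_in_itvoo.
    apply: filterS => x; rewrite in_itv/= => /andP[lx xr].
    by rewrite /= (timeE x)// !ltW.
  apply: is_derive_eq.
  by rewrite add0r mul1r subr0 [LHS]mulr1.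
have derive1_slope s : s \in `]l, r[ -> derive1 (@time R I X \o gamma) s = e.
  by move=> /slope slope_s; rewrite derive1E; exact: derive_val.
have gamma_causal : causal (cst 1) l r gamma.
  split.
  - apply: lipschitz_abs_continuous => s t; rewrite !in_itv/= => slr tlr.
    rewrite /mdist/= (timeE s)// (timeE t)//.
    rewrite (_ : _ - _ = e * (t - s)); last by ring.
    rewrite normrM distrC; case: e1 => ->; rewrite ?normrN normr1 mul1r//.
  - apply: lipschitz_abs_continuous => s t slr tlr.
    by rewrite speed// ler_piMl.
  - case: e1 => eE; [left|right] => s t; rewrite !in_itv/= => slr tlr st;
      rewrite /= (timeE s)// (timeE t)// eE; lra.
  - apply: aeW => s slr; split; first by have [] := slope s slr.
    exists k; last first.
      rewrite derive1_slope// expr1n mul1r addrC subr_le0.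
      by case: e1 => ->; rewrite ?sqrrN expr1n expr_le1.
    have room : 0 < Num.min (s - l) (r - s).
      by move: slr; rewrite in_itv/= => /andP[ls sr]; rewrite lt_min !subr_gt0 ls.
    apply: cvg_near_cst; near=> h.
    have h0 : h != 0 by near: h; exact: nbhs_dnbhs_neq.
    have : `|h| < Num.min (s - l) (r - s) by near: h; exact: dnbhs0_lt.
    rewrite lt_min !ltr_norml => /andP[/andP[? ?] /andP[? ?]].
    rewrite speed ?in_itv/=; [|apply/andP; split; lra..].
    by rewrite opprD addNKr normrN mulfK ?normr_eq0.
case: e1 => eE; [left|right]; split=> //; apply: aeW => s slr;
  by rewrite derive1_slope// eE; lra.
Unshelve. all: by end_near. Qed.

End UnitSpeedPieces.

(** * Zigzags in a compact interval *)

Section Zigzag.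
Context {R : realType}.
Implicit Types (a b m c d t : R) (s : seq R) (alpha : R -> R).

Definition zigzag a b s alpha : Prop := itv_partition a b s /\
  forall i, (i < size s)%N ->
    unit_slope alpha (nth b (a :: s) i) (nth b (a :: s) i.+1).

Lemma zigzag1 a b t e : a < b -> e = 1 \/ e = -1 ->
  zigzag a b [:: b] (fun x => t + e * (x - a)).
Proof.
move=> ab e1; split=> [|[|//] _ /=]; first exact: itv_partition1.
by exists e => // x _; rewrite subrr mulr0 addr0.
Qed.

Lemma zigzag_cat a m b s1 s2 alpha1 alpha2 : alpha1 m = alpha2 m ->
  zigzag a m s1 alpha1 -> zigzag m b s2 alpha2 ->
  zigzag a b (s1 ++ s2) (fun x => if x <= m then alpha1 x else alpha2 x).
Proof.
move=> alpha_m [am slope1] [mb slope2]; split; first exact: itv_partition_cat am mb.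
move=> i; rewrite size_cat; have [i_s1 _|] := ltnP i (size s1).
  have nthE j : (j <= size s1)%N -> nth b (a :: s1 ++ s2) j = nth m (a :: s1) j.
    by move=> j_s1; rewrite -cat_cons nth_cat ltnS j_s1; exact: set_nth_default.
  rewrite !nthE// 1?ltnW//; have [e e1 slope] := slope1 i i_s1.
  exists e => // x /andP[lx xr].
  have rm : nth m (a :: s1) i.+1 <= m by exact: itv_partition_nth_le am.
  by rewrite (le_trans xr rm) (le_trans lx (le_trans xr rm)) slope// lx.
move=> s1_i; rewrite -{1}(subnKC s1_i) ltn_add2l => j_s2.
have nthE j : nth b (a :: s1 ++ s2) (size s1 + j) = nth b (m :: s2) j.
  have [_ /eqP <-] := am; elim: s1 a {am slope1 s1_i j_s2} => [|z s1 ih] a'.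
    by rewrite add0n.
  exact: ih.
rewrite -(subnKC s1_i) -addnS !nthE; set j := (i - _)%N.
have [e e1 slope] := slope2 j j_s2.
have alpha2E x : m <= x -> (if x <= m then alpha1 x else alpha2 x) = alpha2 x.
  by move=> mx; case: ifP => // xm; rewrite (_ : x = m)//; apply/eqP; rewrite eq_le xm mx.
have ml : m <= nth b (m :: s2) j by apply: itv_partition_nth_ge mb; exact: ltnW.
exists e => // x /andP[lx xr]; rewrite !alpha2E ?(le_trans ml)//.
by rewrite slope// lx.
Qed.

(** A path with a single turn: it leaves [t] with slope [e] and arrives at [t']
with slope [- e].  Its range is the convex hull of [t], [t'] and the value at
the turning point, which is the value tested in the last hypothesis. *)
Lemma zigzag_peak a b t t' c d e : `|t' - t| < b - a -> e = 1 \/ e = -1 ->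
  c <= t <= d -> c <= t' <= d ->
  c <= (t + t' + e * (b - a)) / 2 <= d ->
  exists s alpha, [/\ zigzag a b s alpha, alpha a = t, alpha b = t' &
    forall x, a <= x <= b -> c <= alpha x <= d].
Proof.
rewrite ltr_norml => /andP[lo hi] e1 tcd t'cd peak.
pose m := a + ((b - a) + e * (t' - t)) / 2.
have [am mb] : a < m /\ m < b by rewrite /m; case: e1 => ->; split; lra.
have eN1 : - e = 1 \/ - e = -1 by case: e1 => ->; [right|left; rewrite opprK].
exists ([:: m] ++ [:: b]), (fun x => if x <= m then t + e * (x - a)
  else (t + e * (m - a)) + - e * (x - m)); split.
- apply: zigzag_cat; [|exact: zigzag1|exact: zigzag1].
  by rewrite subrr mulr0 addr0.
- by rewrite (ltW am) subrr mulr0 addr0.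
- by rewrite leNgt mb /= /m; case: e1 => ->; lra.
- move=> x /andP[ax xb]; case: (leP x m) => xm; move: peak am mb xm; rewrite /m;
   case: e1 => -> *; lra.
Qed.

(** When [b - a] is at most half of [d - c], one of the two paths with a single
turn stays in [[c, d]].  Longer intervals are bisected, the midpoint being sent
to the mean of [t] and [t'], which preserves the strict Lipschitz bound. *)
Lemma zigzag_exists c d n a b t t' : c < d ->
  b - a <= 2 ^+ n * ((d - c) / 2) -> `|t' - t| < b - a ->
  c <= t <= d -> c <= t' <= d ->
  exists s alpha, [/\ zigzag a b s alpha, alpha a = t, alpha b = t' &
    forall x, a <= x <= b -> c <= alpha x <= d].
Proof.
move=> cd; elim: n a b t t' => [|n ih] a b t t' ba tt' tcd t'cd.
  have [peak|peak] := leP (t + t' + 1 * (b - a)) (2 * d).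
    apply: (@zigzag_peak _ _ _ _ _ _ 1) => //; first by left.
    by move: tt'; rewrite ltr_norml; lra.
  apply: (@zigzag_peak _ _ _ _ _ _ (-1)) => //; first by right.
  by move: tt' ba; rewrite ltr_norml expr0; lra.
pose m := (a + b) / 2; pose u := (t + t') / 2.
have half : 2 ^+ n.+1 * ((d - c) / 2) = 2 * (2 ^+ n * ((d - c) / 2)).
  by rewrite exprS -mulrA.
have ucd : c <= u <= d by rewrite /u; lra.
move: tt'; rewrite ltr_norml => /andP[lo hi].
have [||//|//|s1 [alpha1 [zz1 a1 m1 cd1]]] := ih a m t u.
- by rewrite /m; lra.
- by rewrite ltr_norml /m /u; lra.
have [||//|//|s2 [alpha2 [zz2 m2 b2 cd2]]] := ih m b u t'.
- by rewrite /m; lra.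
- by rewrite ltr_norml /m /u; lra.
have am : a <= m by rewrite /m; lra.
have bm : ~~ (b <= m) by rewrite -ltNge /m; lra.
exists (s1 ++ s2), (fun x => if x <= m then alpha1 x else alpha2 x); split.
- by apply: zigzag_cat => //; rewrite m1.
- by rewrite am.
- by rewrite (negbTE bm).
- move=> x /andP[ax xb]; case: (leP x m) => [xm|mx]; first by apply: cd1; rewrite ax.
  by apply: cd2; rewrite xb ltW.
Qed.

End Zigzag.

(** * The null distance of an unwarped cone *)

Section NullDistanceFormula.
Context {R : realType} {c d : R} {X : metricType R}.
Local Notation I := (`[c, d]%classic).
Implicit Types (p q : gen_cone I X).

Lemma time_itv p : c <= time p <= d.
Proof. by have := set_valP p.1; rewrite /= in_itv. Qed.

Lemma null_dist_refl_le0 p : (null_dist (cst 1%R) p p <= 0)%E.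
Proof.
apply: ereal_inf_lbound; exists 0, 1, [:: 1], (cst p); split=> //.
  split; first exact: itv_partition1.
  by move=> i _; apply: Or31; exists p.
by rewrite /null_length big1// => i _; rewrite subrr normr0.
Qed.

(** A time coordinate of unit speed has null length equal to the length [M] of
its domain, however often it turns. *)
Lemma null_dist_le_of_zigzag p q (k M : R) s alpha (beta : R -> X) :
  0 < M -> 0 <= k <= 1 -> zigzag 0 M s alpha ->
  alpha 0 = time p -> alpha M = time q ->
  (forall x, 0 <= x <= M -> c <= alpha x <= d) ->
  beta 0 = p.2 -> beta M = q.2 ->
  {in `[0, M] &, forall x y, mdist (beta x) (beta y) = k * `|x - y|} ->
  (null_dist (cst 1%R) p q <= M%:E)%E.
Proof.
move=> M0 k01 [part slope] alpha0 alphaM alpha_cd beta0 betaM speed.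
(* The default value p.1 is taken only where alpha leaves [c, d], which does not
   happen on [0, M]. *)
pose gamma x : gen_cone I X := (insubd p.1 (alpha x), beta x).
have timeE x : 0 <= x <= M -> time (gamma x) = alpha x.
  move=> x0M; rewrite /time/= set_valE insubdK//.
  by rewrite inE/= in_itv/= alpha_cd.
pose x i := nth M (0 :: s) i.
have x_itv i : (i <= size s)%N -> 0 <= x i <= M.
  by move=> i_s; rewrite /x (itv_partition_nth_ge _ part)// (itv_partition_nth_le _ part).
have x_le i : (i < size s)%N -> x i <= x i.+1.
  by move=> i_s; have [path_s _] := part; exact/ltW/(pathP M path_s).
have slope_time i : (i < size s)%N ->
    unit_slope (fun y => time (gamma y)) (x i) (x i.+1).
  move=> i_s; have [e e1 alphaE] := slope i i_s; exists e => // y /andP[xy yx].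
  have /andP[xi0 xiM] := x_itv _ (ltnW i_s); have /andP[xS0 xSM] := x_itv _ i_s.
  rewrite !timeE ?xi0 ?xiM ?(le_trans xi0)//=; last exact: le_trans yx xSM.
  by rewrite alphaE// xy.
apply: ereal_inf_lbound; exists 0, M, s, gamma; split=> //.
- split=> // i i_s /=.
  have /andP[xi0 _] := x_itv _ (ltnW i_s); have /andP[_ xSM] := x_itv _ i_s.
  suff : future_causal (cst 1%R) (x i) (x i.+1) gamma \/
         past_causal (cst 1%R) (x i) (x i.+1) gamma.
    by case; [apply: Or32|apply: Or33].
  apply: (@unit_slope_causal _ _ _ _ _ k) => //; first exact: slope_time.
  move=> y z; rewrite !in_itv/= => /andP[xy yx] /andP[xz zx].
  by rewrite speed// in_itv/= ?(le_trans xi0)//= (le_trans _ xSM).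
- by apply: cone_eq; rewrite ?timeE ?lexx ?ltW.
- by apply: cone_eq; rewrite ?timeE ?lexx ?ltW.
- congr (_%:E); rewrite /null_length -[LHS]subr0.
  have {1}<- : x (size s) = M by exact: (itv_partition_nth_size M part).
  have {1}<- : x 0%N = 0 by [].
  rewrite -(telescope_sumr x (leq0n _)) big_mkord; apply: eq_bigr => i _.
  have [e e1 slopeE] := slope_time i (ltn_ord i).
  rewrite -/(x i) -/(x i.+1) (slopeE (x i.+1)) ?lexx ?andbT ?x_le//.
  rewrite addrAC subrr add0r normrM.
  rewrite (ger0_norm (x := _ - _)) ?subr_ge0 ?x_le//.
  by case: e1 => ->; rewrite ?normrN normr1 mul1r.
Qed.

Lemma null_dist_le_max_cone_dist p q : c < d ->
  compact [set: X] -> length_space X ->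
  (null_dist (cst 1%R) p q <= max_cone_dist p q)%E.
Proof.
move=> cd compactX lengthX; rewrite /max_cone_dist; set M := Num.max _ _.
have [timeM distM] : `|time q - time p| <= M /\ mdist p.2 q.2 <= M.
  by rewrite /M !le_max !lexx orbT.
have : 0 <= M by rewrite (le_trans _ distM)// mdist_ge0.
rewrite le_eqVlt => /predU1P[M0|M0].
  suff <- : p = q by rewrite -M0; exact: null_dist_refl_le0.
  apply: cone_eq.
    by apply/esym/eqP; rewrite -subr_eq0 -normr_le0 M0.
  by apply: mdist_positivity; apply/eqP; rewrite eq_le mdist_ge0 M0 distM.
have [geo [geo0 geoL geo_dist]] := geodesic p.2 q.2 compactX lengthX.
(* The speed at which a geodesic has to be run to arrive at time M. *)
pose k := mdist p.2 q.2 / M.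
have kM : k * M = mdist p.2 q.2 by rewrite divfK// gt_eqF.
have k0 : 0 <= k by rewrite divr_ge0 ?mdist_ge0// ltW.
have k1 : k <= 1 by rewrite ler_pdivrMr// mul1r.
suff [s [alpha [zz alpha0 alphaM alpha_cd]]] : exists s alpha,
    [/\ zigzag 0 M s alpha, alpha 0 = time p, alpha M = time q &
      forall x, 0 <= x <= M -> c <= alpha x <= d].
  apply: (@null_dist_le_of_zigzag p q k M s alpha (fun x => geo (k * x))) => //.
  - by rewrite k0.
  - by rewrite mulr0.
  - by rewrite kM.
  - have kx x : x \in `[0, M] -> k * x \in `[0, mdist p.2 q.2].
      rewrite !in_itv/= => /andP[x0 xM]; rewrite mulr_ge0//= -kM.
      exact: ler_wpM2l.
    move=> x y /kx kx0 /kx ky0.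
    by rewrite geo_dist// -mulrBr normrM ger0_norm.
have /andP[cp pd] := time_itv p; have /andP[cq qd] := time_itv q.
move: timeM; rewrite le_eqVlt => /predU1P[MtE|lt_timeM].
  have [e e1 eE] : exists2 e : R, e = 1 \/ e = -1 & time q - time p = e * M.
    rewrite -MtE; have [dt0|dt0] := leP 0 (time q - time p).
      by exists 1; [left|rewrite mul1r ger0_norm].
    by exists (-1); [right|rewrite mulN1r ltr0_norm// opprK].
  exists [:: M], (fun x => time p + e * (x - 0)); split.
  - exact: zigzag1.
  - by rewrite subrr mulr0 addr0.
  - by rewrite subr0 -eE addrC subrK.
  - by move=> x; case: e1 eE => -> eE /andP[x0 xM]; lra.
have [n Mn] : exists n, M - 0 <= 2 ^+ n * ((d - c) / 2).
  have dc0 : 0 < (d - c) / 2 by rewrite divr_gt0// subr_gt0.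
  exists (Num.bound (M / ((d - c) / 2))); rewrite subr0 -ler_pdivrMr//.
  set z := M / _; have z0 : 0 <= z by rewrite divr_ge0// ltW.
  rewrite (le_trans (ltW (archi_boundP z0)))// -natrX ler_nat ltnW//.
  exact: ltn_expl.
apply: (@zigzag_exists _ c d n) => //.
- by rewrite subr0.
- by rewrite cp.
- by rewrite cq.
Qed.

Lemma null_distE : c < d -> compact [set: X] -> length_space X ->
  null_dist (cst 1%R) = @max_cone_dist R I X.
Proof.
move=> cd compactX lengthX; apply/funext => p; apply/funext => q; apply/eqP.
by rewrite eq_le null_dist_le_max_cone_dist//= max_cone_dist_le_null_dist.
Qed.

End NullDistanceFormula.

Theorem proposition4p19 (R : realType) (c d : R) (X_ : nat -> metricType R)
    (X : metricType R) :
  c < d ->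
  (forall n, compact [set: X_ n]) -> (forall n, length_space (X_ n)) ->
  compact [set: X] -> length_space X ->
  gh_cvg (fun n => @dist_of R (X_ n)) (@dist_of R X) ->
  gh_cvg (fun n => @null_dist R `[c, d]%classic (X_ n) (cst 1))
         (@null_dist R `[c, d]%classic X (cst 1)).
Proof.
move=> cd compactX_ lengthX_ compactX lengthX X_X.
rewrite /gh_cvg (null_distE cd compactX lengthX).
under eq_fun do rewrite (null_distE cd (compactX_ _) (lengthX_ _)).
exact: gh_cvg_cone.
Qed.
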